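(* Let $G\rightrightarrows Q$ and $G'\rightrightarrows Q'$ be Lie groupoids, let $L_d:G_2\to\mathbb{R}$ and $L_d':G_2'\to\mathbb{R}$ be discrete second-order Lagrangians, and let $\chi:\mathcal{P}^{\alpha}G\to\mathcal{P}^{\alpha'}G'$ be a morphism of Lie groupoids satisfying $G_2=\chi^{-1}(G_2')$ and $L_d=L_d'\circ\chi|_{G_2}$. If $\mu\in T^*(\mathcal{P}^{\alpha}G)$ and $\mu'\in T^*(\mathcal{P}^{\alpha'}G')$ are $\chi^*$-related, then: 1. If $\mu'\in\Sigma_{L_d'}$ then $\mu\in\Sigma_{L_d}$. 2. The sources $\tilde\alpha(\mu)\in A^*(\mathcal{P}^{\alpha}G)$ and $\tilde\alpha'(\mu')\in A^*(\mathcal{P}^{\alpha'}G')$ are $A^*\chi$-related. 3. The targets $\tilde\beta(\mu)\in A^*(\mathcal{P}^{\alpha}G)$ and $\tilde\beta'(\mu')\in A^*(\mathcal{P}^{\alpha'}G')$ are $A^*\chi$-related.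
   Context: A Lie groupoid $G\rightrightarrows Q$ has source $\alpha$, target $\beta$, identity section $\epsilon$, inversion $i$, and multiplication $gh$ defined on $G_2=\{(g,h)\in G\times G\mid\beta(g)=\alpha(h)\}$. Left and right translations are $\ell_g(h)=gh$, $r_g(h)=hg$. The Lie algebroid $AG\to Q$ has fibre $A_qG=\ker T_{\epsilon(q)}\alpha$; a section $X$ determines the left-invariant vector field $\overleftarrow{X}(g)=T_{\epsilon(\beta(g))}\ell_g(X(\beta(g)))$ and the right-invariant vector field $\overrightarrow{X}(g)=-T_{\epsilon(\alpha(g))}(r_g\circ i)(X(\alpha(g)))$. The same definitions apply to any Lie groupoid; primes denote the corresponding objects for $G'\rightrightarrows Q'$. A discrete second-order Lagrangian is a smooth function $L_d:G_2\to\mathbb{R}$. The prolongation of $G$ over $\alpha$ is the Lie groupoid $$\mathcal{P}^{\alpha}G=\{(g,h,r)\in G\times G\times G\mid \alpha(g)=\alpha(h),\ \beta(h)=\alpha(r)\}\rightrightarrows G,$$ with source $(g,h,r)\mapsto g$, target $(g,h,r)\mapsto r$, multiplication $(g,h,r)(r,h',s)=(g,hh',s)$, identity $g\mapsto(g,\epsilon(\alpha(g)),g)$ and inversion $(g,h,r)\mapsto(r,h^{-1},g)$. Its Lie algebroid is $A(\mathcal{P}^{\alpha}G)\to G$. $G_2$ is regarded as a subset of $\mathcal{P}^{\alpha}G$ via $i_{G_2}:G_2\hookrightarrow\mathcal{P}^{\alpha}G$, $i_{G_2}(g,h)=(g,g,h)$ (and similarly for $G'$). The cotangent groupoid $T^*(\mathcal{P}^{\alpha}G)\rightrightarrows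 A^*(\mathcal{P}^{\alpha}G)$ has source and target given, for $\mu\in T^*_{(g,h,r)}(\mathcal{P}^{\alpha}G)$, by $\tilde\alpha(\mu)\in A_g^*(\mathcal{P}^{\alpha}G)$, $\langle\tilde\alpha(\mu),Z(g)\rangle=\langle\mu,\overrightarrow{Z}(g,h,r)\rangle$, and $\tilde\beta(\mu)\in A_r^*(\mathcal{P}^{\alpha}G)$, $\langle\tilde\beta(\mu),Z(r)\rangle=\langle\mu,\overleftarrow{Z}(g,h,r)\rangle$, for all sections $Z$ of $A(\mathcal{P}^{\alpha}G)$. The Lagrangian submanifold generated by $L_d$ is $\Sigma_{L_d}=\{\mu\in T^*(\mathcal{P}^{\alpha}G)\mid i_{G_2}^*\mu=dL_d\}$ (covectors based at points of $i_{G_2}(G_2)$). A morphism of Lie groupoids is a smooth map sending composable pairs to composable pairs and preserving products; $\chi$ induces a smooth map on bases $\chi_0:G\to G'$ and a Lie algebroid morphism $A\chi:A(\mathcal{P}^{\alpha}G)\to A(\mathcal{P}^{\alpha'}G')$ (the restriction of $T\chi$). Covectors $\mu\in T^*_x(\mathcal{P}^{\alpha}G)$ and $\mu'\in T^*_{\chi(x)}(\mathcal{P}^{\alpha'}G')$ are $\chi^*$-related if $\langle\mu,\xi\rangle=\langle\mu',T\chi(\xi)\rangle$ for all $\xi\in T_x(\mathcal{P}^{\alpha}G)$. Elements $z\in A^*_g(\mathcal{P}^{\alpha}G)$ and $z'\in A^*_{\chi_0(g)}(\mathcal{P}^{\alpha'}G')$ ($g\in G$) are $A^*\chi$-related if $\langle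 z,\xi\rangle=\langle z',A\chi(\xi)\rangle$ for all $\xi\in A_g(\mathcal{P}^{\alpha}G)$. *)

(* Defs.v *)
(* Smooth geometry over MathComp-Analysis. A smooth space is presented by a
   topological space together with a family of real functions generating its
   sheaf of smooth functions (differential spaces in the sense of Sikorski).
   A manifold is such a space that is Hausdorff, second countable and locally
   diffeomorphic to R^n. Products and subsets (fibre products, source fibres)
   carry the induced structures; on products and embedded submanifolds of
   manifolds these are the usual manifold structures. *)
From HB Require Import structures.
From mathcomp Require Import all_boot all_order all_algebra.
From mathcomp Require Import all_classical all_reals all_analysis.
Set Implicit Arguments.
Unset Strict Implicit.
Unset Printing Implicit Defensive.
Import Order.TTheory GRing.Theory Num.Theory.
Import numFieldNormedType.Exports.
Local Open Scope classical_set_scope.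
Local Open Scope ring_scope.

Section SmoothSpaces.
Variable R : realType.

(* For finite-dimensional V and U open: f is C^oo on U, i.e. all iterated
   directional derivatives of f are differentiable on U. *)
Definition Cinfty_on (V : normedModType R) (U : set V) (f : V -> R) : Prop :=
  forall (s : seq V) (x : V), U x ->
    differentiable (foldr (fun v g => 'D_v g) f s : V -> R) x.

Record dspace := DSpace {
  dcar :> topologicalType;
  dgen : set (dcar -> R) }.

(* f is, near x, a C^oo function of finitely many generators *)
Definition smooth_at (M : dspace) (f : M -> R) (x : M) : Prop :=
  exists n (phi : 'I_n -> (M -> R)) (w : 'rV[R]_n -> R),
    [/\ forall i, dgen (phi i), Cinfty_on setT w
      & \forall y \near x, f y = w (\row_i phi i y)].

Definition smooth_fun (M : dspace) (f : M -> R) : Prop :=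
  forall x, smooth_at f x.

Definition smooth_map (M N : dspace) (F : M -> N) : Prop :=
  continuous F /\ forall f : N -> R, smooth_fun f -> smooth_fun (f \o F).

Definition dsub (M : dspace) (A : set M) : dspace :=
  @DSpace (set_type A)
    [set g | exists2 f : M -> R, smooth_fun f & g = f \o @set_val _ A].

Definition dprod (M N : dspace) : dspace :=
  @DSpace (M * N)%type
    [set g | (exists2 f : M -> R, smooth_fun f & g = f \o fst)
          \/ (exists2 f : N -> R, smooth_fun f & g = f \o snd)].

(* phi : U -> W is a diffeomorphism of an open set of M onto an open set of
   R^n, with inverse psi. *)
Definition is_chart (M : dspace) n (U : set M) (W : set 'rV[R]_n)
    (phi : M -> 'rV[R]_n) (psi : 'rV[R]_n -> M) : Prop :=
  [/\ open U /\ open W,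
      forall x, U x -> W (phi x) /\ psi (phi x) = x,
      forall y, W y -> U (psi y) /\ phi (psi y) = y,
      (forall x, U x -> {for x, continuous phi}) /\
      (forall i x, U x -> smooth_at (fun z => phi z ord0 i) x)
    & (forall y, W y -> {for y, continuous psi}) /\
      (forall f : M -> R, smooth_fun f -> Cinfty_on W (f \o psi))].

Definition is_manifold (M : dspace) : Prop :=
  [/\ hausdorff_space M, @second_countable M
    & exists n, forall x : M, exists U (W : set 'rV[R]_n) phi psi,
        is_chart U W phi psi /\ U x].

(* In suitable charts around every point, F is the projection
   R^(m + k) -> R^m (first m coordinates). *)
Definition is_submersion (M N : dspace) (F : M -> N) : Prop :=
  smooth_map F /\
  forall x, exists m k
      U (W : set 'rV[R]_(m + k)) phi psi U' (W' : set 'rV[R]_m) phi' psi',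
    [/\ @is_chart M _ U W phi psi, @is_chart N _ U' W' phi' psi', U x,
        F @` U `<=` U'
      & forall y, U y -> phi' (F y) = lsubmx (phi y)].

(* Tangent vectors are classes of smooth curves through x. Two curves are
   identified when they differentiate every smooth function in the same way,
   so a class is represented by the functional f |-> (f o c)'(0), extended by 0
   to the non-smooth f. *)
Definition tvec (M : dspace) : Type := (M -> R) -> R.

Definition smooth_curve (M : dspace) (e : R) (c : R -> M) : Prop :=
  (forall t, `|t| < e -> {for t, continuous c}) /\
  (forall f : M -> R, smooth_fun f ->
     Cinfty_on [set t : R | `|t| < e] (f \o c)).

Definition velocity (M : dspace) (c : R -> M) : tvec M :=
  fun f => if `[< smooth_fun f >] then derive1 (f \o c) 0 else 0.

Definition tangent (M : dspace) (x : M) : set (tvec M) :=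
  [set v | exists e c,
     [/\ 0 < e, smooth_curve e c, c 0 = x & v = velocity c]].

Definition push (M N : dspace) (F : M -> N) (v : tvec M) : tvec N :=
  fun f => if `[< smooth_fun f >] then v (f \o F) else 0.

Definition tadd (M : dspace) (a : R) (v w : tvec M) : tvec M :=
  fun f => a * v f + w f.

Definition topp (M : dspace) (v : tvec M) : tvec M := fun f => - v f.

Definition tzero (M : dspace) : tvec M := fun=> 0.

(* A vector X of M that is tangent to A at p, seen in T_p A: the vector of
   T_p A that T(incl) sends to X (T(incl) is injective). *)
Definition tsub (M : dspace) (A : set M) (p : dsub A) (X : tvec M) :
    tvec (dsub A) :=
  xget (@tzero (dsub A))
    [set Y | tangent p Y /\ push (@set_val _ A : dsub A -> M) Y = X].

Record cotangent (M : dspace) := Cotangent {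
  cpt : M;
  cval : tvec M -> R;
  clin : forall a v w, tangent cpt v -> tangent cpt w ->
    cval (tadd a v w) = a * cval v + cval w }.

End SmoothSpaces.

Section Groupoids.
Variable R : realType.

Record groupoid := Groupoid {
  arr : dspace R;
  obj : dspace R;
  src : arr -> obj;
  tgt : arr -> obj;
  one : obj -> arr;
  inv : arr -> arr;
  mul : forall g h : arr, tgt g = src h -> arr;
  src_mul : forall g h (e : tgt g = src h), src (mul e) = src g;
  tgt_mul : forall g h (e : tgt g = src h), tgt (mul e) = tgt h;
  mul_assoc : forall g h k (e1 : tgt g = src h) (e2 : tgt h = src k)
      (e3 : tgt (mul e1) = src k) (e4 : tgt g = src (mul e2)),
      mul e3 = mul e4;
  src_one : forall q, src (one q) = q;
  tgt_one : forall q, tgt (one q) = q;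
  one_mul : forall g (e : tgt (one (src g)) = src g), mul e = g;
  mul_one : forall g (e : tgt g = src (one (tgt g))), mul e = g;
  src_inv : forall g, src (inv g) = tgt g;
  tgt_inv : forall g, tgt (inv g) = src g;
  mul_inv : forall g (e : tgt g = src (inv g)), mul e = one (src g);
  inv_mul : forall g (e : tgt (inv g) = src g), mul e = one (tgt g) }.

Definition composable_set (H : groupoid) : set (dprod (arr H) (arr H)) :=
  [set p | tgt p.1 = src p.2].

Definition composable (H : groupoid) : dspace R := dsub (@composable_set H).

Definition fst2 (H : groupoid) (p : composable H) : arr H := (set_val p).1.
Definition snd2 (H : groupoid) (p : composable H) : arr H := (set_val p).2.

Lemma composableP (H : groupoid) (p : composable H) :
  tgt (fst2 p) = src (snd2 p).
Proof. exact: (set_valP p). Qed.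

(* src and tgt are surjective by src_one and tgt_one. *)
Definition is_lie_groupoid (H : groupoid) : Prop :=
  [/\ is_manifold (arr H) /\ is_manifold (obj H),
      is_submersion (@src H) /\ is_submersion (@tgt H),
      smooth_map (@one H), smooth_map (@inv H)
    & smooth_map (fun p : composable H => mul (composableP p) : arr H)].

Section Algebroid.
Variable H : groupoid.

Definition algebroid (q : obj H) : set (tvec (arr H)) :=
  [set X | tangent (one q) X /\ push (@src H) X = @tzero R (obj H)].

Definition srcfib_set (q : obj H) : set (arr H) := [set h | src h = q].

Definition srcfib (q : obj H) : dspace R := dsub (@srcfib_set q).

Definition srcfib_one (q : obj H) : srcfib q :=
  SigSub (mem_set (src_one q : srcfib_set q (one q))).

Lemma ltrans_subproof (g : arr H) (h : srcfib (tgt g)) :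
  tgt g = src (set_val h).
Proof. by rewrite (set_valP h). Qed.

(* ell_g : alpha^-1(beta(g)) -> G *)
Definition ltrans (g : arr H) (h : srcfib (tgt g)) : arr H :=
  mul (ltrans_subproof h).

Lemma rtrans_inv_subproof (g : arr H) (h : srcfib (src g)) :
  tgt (inv (set_val h)) = src g.
Proof. by rewrite tgt_inv (set_valP h). Qed.

(* r_g o i : alpha^-1(alpha(g)) -> G *)
Definition rtrans_inv (g : arr H) (h : srcfib (src g)) : arr H :=
  mul (rtrans_inv_subproof h).

(* For a section X of the algebroid, the left- and right-invariant vector
   fields at g are left_inv g (X (tgt g)) and right_inv g (X (src g)). *)
Definition left_inv (g : arr H) (X : tvec (arr H)) : tvec (arr H) :=
  push (@ltrans g) (tsub (srcfib_one (tgt g)) X).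

Definition right_inv (g : arr H) (X : tvec (arr H)) : tvec (arr H) :=
  topp (push (@rtrans_inv g) (tsub (srcfib_one (src g)) X)).

(* An element of the dual bundle: a base point q and a functional, of which
   only the values on algebroid q are relevant. *)
Definition dual_elt : Type := (obj H * (tvec (arr H) -> R))%type.

Definition cot_src (mu : cotangent (arr H)) : dual_elt :=
  (src (cpt mu), fun Z => cval mu (right_inv (cpt mu) Z)).

Definition cot_tgt (mu : cotangent (arr H)) : dual_elt :=
  (tgt (cpt mu), fun Z => cval mu (left_inv (cpt mu) Z)).

End Algebroid.

Section Morphism.
Variables (H H' : groupoid) (chi : arr H -> arr H').

Definition is_morphism : Prop :=
  smooth_map chi /\
  forall (x y : arr H) (e : tgt x = src y),
    exists e' : tgt (chi x) = src (chi y), chi (mul e) = mul e'.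

Definition base_map (q : obj H) : obj H' := src (chi (one q)).

Definition cot_related (mu : cotangent (arr H)) (mu' : cotangent (arr H')) :
    Prop :=
  cpt mu' = chi (cpt mu) /\
  forall xi, tangent (cpt mu) xi -> cval mu xi = cval mu' (push chi xi).

Definition dual_related (z : dual_elt H) (z' : dual_elt H') : Prop :=
  z'.1 = base_map z.1 /\
  forall xi, algebroid z.1 xi -> z.2 xi = z'.2 (push chi xi).

End Morphism.

Section Prolongation.
Variable G : groupoid.

Definition prolong_set : set (dprod (dprod (arr G) (arr G)) (arr G)) :=
  [set p | src p.1.1 = src p.1.2 /\ tgt p.1.2 = src p.2].

Definition prolong_arr : dspace R := dsub prolong_set.

Definition mk_prolong (g h r : arr G)
    (e : src g = src h /\ tgt h = src r) : prolong_arr :=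
  SigSub (mem_set (e : prolong_set (g, h, r))).

Definition psrc (x : prolong_arr) : arr G := (set_val x).1.1.
Definition pmid (x : prolong_arr) : arr G := (set_val x).1.2.
Definition ptgt (x : prolong_arr) : arr G := (set_val x).2.

Lemma prolongP (x : prolong_arr) :
  src (psrc x) = src (pmid x) /\ tgt (pmid x) = src (ptgt x).
Proof. exact: (set_valP x). Qed.

Lemma prolong_eq (x y : prolong_arr) :
  psrc x = psrc y -> pmid x = pmid y -> ptgt x = ptgt y -> x = y.
Proof.
case: x => [[[a b] c] ?]; case: y => [[[a' b'] c'] ?] /=.
by rewrite /psrc /pmid /ptgt /= => ? ? ?; apply: val_inj => /=; congr (_, _, _).
Qed.

Lemma mul_congr (g h g' h' : arr G) (e : tgt g = src h)
  (e' : tgt g' = src h') : g = g' -> h = h' -> mul e = mul e'.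
Proof.
move=> eg eh; move: e e'; rewrite eg eh => e e'.
by rewrite (Prop_irrelevance e e').
Qed.

Lemma pone_subproof (g : arr G) :
  src g = src (one (src g)) /\ tgt (one (src g)) = src g.
Proof. by rewrite src_one tgt_one. Qed.

Definition pone (g : arr G) : prolong_arr := mk_prolong (pone_subproof g).

Lemma pinv_subproof (x : prolong_arr) :
  src (ptgt x) = src (inv (pmid x)) /\ tgt (inv (pmid x)) = src (psrc x).
Proof. by have [e1 e2] := prolongP x; rewrite src_inv tgt_inv. Qed.

Definition pinv (x : prolong_arr) : prolong_arr :=
  mk_prolong (pinv_subproof x).

Lemma pmid_composable (x y : prolong_arr) :
  ptgt x = psrc y -> tgt (pmid x) = src (pmid y).
Proof. by move=> e; rewrite (prolongP x).2 e (prolongP y).1. Qed.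

Lemma pmul_subproof (x y : prolong_arr) (e : ptgt x = psrc y) :
  src (psrc x) = src (mul (pmid_composable e)) /\
  tgt (mul (pmid_composable e)) = src (ptgt y).
Proof. by rewrite src_mul tgt_mul (prolongP x).1 (prolongP y).2. Qed.

Definition pmul (x y : prolong_arr) (e : ptgt x = psrc y) : prolong_arr :=
  mk_prolong (pmul_subproof e).

Definition prolongation : groupoid.
Proof.
refine (@Groupoid prolong_arr (arr G) psrc ptgt pone pinv pmul
          _ _ _ _ _ _ _ _ _ _ _) => //.
- move=> g h k e1 e2 e3 e4; apply: prolong_eq => //=.
  rewrite /pmul /pmid /=.
  have e3' : tgt (mul (pmid_composable e1)) = src (pmid k).
    by rewrite tgt_mul; exact: pmid_composable.
  have e4' : tgt (pmid g) = src (mul (pmid_composable e2)).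
    by rewrite src_mul; exact: pmid_composable.
  transitivity (mul e3'); first exact: mul_congr.
  by rewrite (mul_assoc e3' e4'); exact: mul_congr.
- move=> x e; apply: prolong_eq => //.
  have e' : tgt (one (src (pmid x))) = src (pmid x) by rewrite tgt_one.
  rewrite -[RHS](one_mul e'); apply: mul_congr => //.
  by rewrite -(prolongP x).1.
- move=> x e; apply: prolong_eq => //.
  have e' : tgt (pmid x) = src (one (tgt (pmid x))) by rewrite src_one.
  rewrite -[RHS](mul_one e'); apply: mul_congr => //.
  by rewrite (prolongP x).2.
- move=> x e; apply: prolong_eq => //.
  have e' : tgt (pmid x) = src (inv (pmid x)) by rewrite src_inv.
  transitivity (mul e'); first exact: mul_congr.
  by rewrite mul_inv -(prolongP x).1.
- move=> x e; apply: prolong_eq => //.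
  have e' : tgt (inv (pmid x)) = src (pmid x) by rewrite tgt_inv.
  transitivity (mul e'); first exact: mul_congr.
  by rewrite inv_mul (prolongP x).2.
Defined.

Lemma iG2_subproof (p : composable G) :
  src (fst2 p) = src (fst2 p) /\ tgt (fst2 p) = src (snd2 p).
Proof. by split=> //; exact: composableP. Qed.

Definition iG2 (p : composable G) : arr prolongation :=
  mk_prolong (iG2_subproof p).

(* dL applied to a tangent vector v is v L. *)
Definition Sigma (L : composable G -> R) : set (cotangent (arr prolongation)) :=
  [set mu | exists p : composable G, cpt mu = iG2 p /\
     forall v, tangent p v -> cval mu (push iG2 v) = v L].

End Prolongation.

End Groupoids.

(* Main.v *)
(* A morphism chi of groupoids commutes with left and right translations, so a
   vector of a source fibre is carried by T chi to the vector translated in the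
   same way; dualizing this gives the statements on sources and targets. The
   statement on Sigma holds because chi restricts to a smooth map G_2 -> G'_2
   that pulls L' back to L.

   In the curve model of tangent vectors, translating a vector X of the
   algebroid at q requires a curve inside the source fibre of q with velocity
   X. A curve (g, h, r) of P^alpha G representing X has g' = 0; since alpha is a
   submersion, h can be moved without changing its velocity to a curve over the
   constant alpha(q), and then r to a curve over beta(h). *)
From Pilot Require Import Defs.
From HB Require Import structures.
From mathcomp Require Import all_boot all_order all_algebra.
From mathcomp Require Import all_classical all_reals all_analysis.
Set Implicit Arguments.
Unset Strict Implicit.
Unset Printing Implicit Defensive.
Import Order.TTheory GRing.Theory Num.Theory.
Import numFieldNormedType.Exports.
(* Otherwise [mul], [one], [inv] denote library constants. *)
Import Pilot.Defs.
Local Open Scope classical_set_scope.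
Local Open Scope ring_scope.

(** * Calculus *)

Section Calculus.
Variable R : realType.
Implicit Types V W : normedModType R.

(** Near [x] the remainder vanishes identically, hence is little-o, so [diff_unique] identifies the
    differential with the zero map. *)
Lemma differentiable_near0 V (h : V -> R) (x : V) :
  (\forall y \near x, h y = 0) -> differentiable h x.
Proof.
move=> h0; have hx : h x = 0 by exact: nbhs_singleton h0.
have D : h \o shift x = cst (h x) + (\0 : {linear V -> R}) +o_ 0 id.
  apply/eqaddoP => _/posnumP[e].
  move: h0; rewrite (near_shift 0) subr0; apply: filterS => y /= hy.
  by rewrite !fctE /= hx addr0 subr0 hy normr0 mulr_ge0.
have C : continuous (\0 : {linear V -> R}) by move=> z; exact: cvg_cst.
by apply/diff_locallyP; rewrite (diff_unique C D).
Qed.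

Lemma near_eq_differentiable V (f g : V -> R) (x : V) :
  (\forall y \near x, f y = g y) -> differentiable f x -> differentiable g x.
Proof.
move=> fg df; have -> : g = f + (g - f) by rewrite addrC subrK.
apply: differentiableD => //; apply: differentiable_near0.
by apply: filterS fg => y fgy; rewrite !fctE fgy subrr.
Qed.

(** * Finite orders of differentiability *)

Definition derivs V (f : V -> R) (s : seq V) : V -> R :=
  foldr (fun v g => 'D_v g) f s.

Lemma eq_derivs V (U : set V) (f g : V -> R) s x : open U ->
  (forall y, U y -> f y = g y) -> U x -> derivs f s x = derivs g s x.
Proof.
move=> oU fg; elim: s x => [|v s IH] x Ux /=; first exact: fg.
apply: near_eq_derive; near=> y; apply: IH.
by near: y; exact: open_nbhs_nbhs.
Unshelve. all: by end_near. Qed.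

(** Grading by the number of derivatives permits induction on [k] for products and compositions,
    where induction on the list of directions fails: the derivative of a product is a sum of
    products. The derivatives counted must themselves be differentiable, so [k = 0] already means
    differentiable. *)
Definition Ck_on V (k : nat) (U : set V) (f : V -> R) :=
  forall s x, (size s <= k)%N -> U x -> differentiable (derivs f s) x.

Lemma Cinfty_onP V (U : set V) f : Cinfty_on U f <-> forall k, Ck_on k U f.
Proof.
split=> [h k s x _ Ux|h s x Ux]; first exact: h.
exact: (h (size s) s x).
Qed.

Lemma eq_Ck_on V k (U : set V) f g : open U ->
  (forall x, U x -> f x = g x) -> Ck_on k U f -> Ck_on k U g.
Proof.
move=> oU fg hf s x sk Ux.
apply: (near_eq_differentiable (f := derivs f s)); last exact: hf.
near=> y; apply: (@eq_derivs _ U) => //.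
by near: y; exact: open_nbhs_nbhs.
Unshelve. all: by end_near. Qed.

Lemma Ck_onW V k (U : set V) f : Ck_on k.+1 U f -> Ck_on k U f.
Proof. by move=> h s x sk; apply: h; exact: leqW. Qed.

Lemma Ck_on0 V (U : set V) f :
  Ck_on 0 U f <-> forall x, U x -> differentiable f x.
Proof.
split=> [h x Ux|h s x]; first exact: (h [::]).
by case: s => // _ Ux; exact: h.
Qed.

(** The head of the list is the outermost derivative. The direction split off is the last one, so
    that [f] itself is replaced by a derivative. *)
Lemma Ck_onS V k (U : set V) f :
  Ck_on k.+1 U f <-> ((forall x, U x -> differentiable f x) /\
                     forall v, Ck_on k U ('D_v f)).
Proof.
split=> [h|[h1 h2] s x].
  split=> [x Ux|v s x sk Ux]; first exact: (h [::]).
  have := h (rcons s v) x; rewrite size_rcons /derivs foldr_rcons; exact.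
case/lastP: s => [_ Ux|s v]; first exact: h1.
rewrite size_rcons ltnS /derivs foldr_rcons; exact: h2.
Qed.

Lemma derivs_cst0 V (s : seq V) : derivs (cst (0:R)) s = cst 0.
Proof.
elim: s => //= v s ->; apply/funext => x; exact: derive_cst.
Qed.

Lemma Ck_on_cst V k (U : set V) (a : R) : Ck_on k U (cst a).
Proof.
case: k => [|k]; first by apply/Ck_on0.
apply/Ck_onS; split=> // v.
have -> : 'D_v (cst a) = cst 0 :> (V -> R).
  by apply/funext => x; exact: derive_cst.
by move=> s x _ _; rewrite derivs_cst0.
Qed.

Lemma Ck_onD V k (U : set V) f g : open U ->
  Ck_on k U f -> Ck_on k U g -> Ck_on k U (f + g).
Proof.
move=> oU; elim: k f g => [|k IH] f g.
  move=> /Ck_on0 hf /Ck_on0 hg; apply/Ck_on0 => x Ux.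
  by apply: differentiableD; auto.
move=> /Ck_onS[df hf] /Ck_onS[dg hg]; apply/Ck_onS; split=> [x Ux|v].
  by apply: differentiableD; auto.
apply: (eq_Ck_on (f := 'D_v f + 'D_v g)) => //; last exact: IH.
by move=> x Ux; rewrite deriveD //; apply: diff_derivable; auto.
Qed.

Lemma Ck_onM V k (U : set V) f g : open U ->
  Ck_on k U f -> Ck_on k U g -> Ck_on k U (f * g).
Proof.
move=> oU; elim: k f g => [|k IH] f g.
  move=> /Ck_on0 hf /Ck_on0 hg; apply/Ck_on0 => x Ux.
  by apply: differentiableM; auto.
move=> Hf Hg; have [df hf] := (Ck_onS _ _ _).1 Hf.
have [dg hg] := (Ck_onS _ _ _).1 Hg; apply/Ck_onS; split=> [x Ux|v].
  by apply: differentiableM; auto.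
apply: (eq_Ck_on (f := f * 'D_v g + g * 'D_v f)) => //.
  by move=> x Ux; rewrite deriveM //; apply: diff_derivable; auto.
by apply: Ck_onD => //; apply: IH => //; apply: Ck_onW.
Qed.

Lemma Ck_on_sum V k (U : set V) n (f : 'I_n -> V -> R) : open U ->
  (forall i, Ck_on k U (f i)) -> Ck_on k U (\sum_i f i).
Proof.
move=> oU h; elim/big_ind: _ => [|f1 f2 h1 h2|i _]; last exact: h.
  exact: (@Ck_on_cst V k U 0).
exact: Ck_onD.
Qed.

(** * Row-valued functions and the chain rule in coordinates *)

Lemma rowE_fun V n (w : 'I_n -> V -> R) :
  (fun y => \row_i w i y) =
  \sum_i (fun y => w i y *: delta_mx 0 i) :> (V -> 'rV[R]_n).
Proof.
apply/funext => y; rewrite fct_sumE; apply/rowP => j; rewrite mxE summxE.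
rewrite (bigD1 j) //= !mxE !eqxx mulr1 big1 ?addr0 // => i ij.
by rewrite !mxE /= eq_sym (negbTE ij) mulr0.
Qed.

Lemma differentiable_row V n (w : 'I_n -> V -> R) x :
  (forall i, differentiable (w i) x) ->
  differentiable (fun y => \row_i w i y) x.
Proof.
move=> h; rewrite rowE_fun; apply: differentiable_sum => i.
exact: differentiableZl.
Qed.

Lemma derive_row V n (w : 'I_n -> V -> R) x v :
  (forall i, differentiable (w i) x) ->
  'D_v (fun y => \row_i w i y) x = \sum_i 'D_v (w i) x *: delta_mx 0 i.
Proof.
move=> h; rewrite rowE_fun derive_sum => [|i].
  apply: eq_bigr => i _; rewrite deriveE; last exact: differentiableZl.
  by rewrite diffZl // deriveE.
by apply/diff_derivable/differentiableZl.
Qed.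

Lemma derive_comp_row V n (f : 'rV[R]_n -> R) (w : 'I_n -> V -> R) x v :
  (forall i, differentiable (w i) x) ->
  differentiable f (\row_i w i x) ->
  'D_v (fun y => f (\row_i w i y)) x =
  \sum_i 'D_(delta_mx 0 i) f (\row_i w i x) * 'D_v (w i) x.
Proof.
move=> hw hf; have hW := differentiable_row hw.
have hc := differentiable_comp (g := f) hW hf.
rewrite (deriveE _ hc) (diff_comp (g := f) hW hf) /= -(deriveE _ hW).
rewrite derive_row // linear_sum /=; apply: eq_bigr => i _.
by rewrite linearZ /= (deriveE _ hf) [LHS]mulrC.
Qed.

(** By the chain rule a derivative is a sum of products of a partial derivative of [f] composed with
    [w], covered by induction since [f] is general, and a derivative of some [w i]. *)
Lemma Ck_on_comp V k n (U : set V) (O : set 'rV[R]_n) f w : open U ->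
  (forall x, U x -> O (\row_i w i x)) ->
  (forall i, Ck_on k U (w i)) -> Ck_on k O f ->
  Ck_on k U (fun y => f (\row_i w i y)).
Proof.
move=> oU UO; elim: k f => [|k IH] f hw hf.
  apply/Ck_on0 => x Ux; apply: (@differentiable_comp _ _ _ _ _ f).
    by apply: differentiable_row => i; have /Ck_on0 := hw i; apply.
  by have /Ck_on0 := hf; apply; exact: UO.
have [df hf'] := (Ck_onS _ _ _).1 hf.
have dw i := ((Ck_onS _ _ _).1 (hw i)).1.
have hw' i := ((Ck_onS _ _ _).1 (hw i)).2.
apply/Ck_onS; split=> [x Ux|v].
  apply: (@differentiable_comp _ _ _ _ _ f); last by apply: df; exact: UO.
  by apply: differentiable_row => i; exact: dw.
apply: (eq_Ck_on (f := \sum_i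
  ((fun x => 'D_(delta_mx 0 i) f (\row_i w i x)) * 'D_v (w i)))) => //.
  move=> x Ux; rewrite derive_comp_row ?fct_sumE //.
    by move=> i; exact: dw.
  by apply: df; exact: UO.
apply: Ck_on_sum => // i; apply: Ck_onM => //.
by apply: (IH ('D_(delta_mx 0 i) f)) => // j; exact: Ck_onW.
Qed.

Lemma Cinfty_on_comp V n (U : set V) (O : set 'rV[R]_n) f w : open U ->
  (forall x, U x -> O (\row_i w i x)) ->
  (forall i, Cinfty_on U (w i)) -> Cinfty_on O f ->
  Cinfty_on U (fun y => f (\row_i w i y)).
Proof.
move=> oU UO hw /Cinfty_onP hf; apply/Cinfty_onP => k.
by apply: (@Ck_on_comp _ _ _ U O) => // i; have /Cinfty_onP := hw i.
Qed.

Lemma eq_Cinfty_on V (U : set V) f g : open U ->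
  (forall x, U x -> f x = g x) -> Cinfty_on U f -> Cinfty_on U g.
Proof.
move=> oU fg /Cinfty_onP hf; apply/Cinfty_onP => k.
exact: (eq_Ck_on oU fg).
Qed.

Lemma Cinfty_on_cst V (U : set V) (a : R) : Cinfty_on U (cst a).
Proof. apply/Cinfty_onP => k; exact: Ck_on_cst. Qed.

Lemma Cinfty_on_coord n (U : set 'rV[R]_n) i :
  Cinfty_on U (fun x => x ord0 i).
Proof.
apply/Cinfty_onP => -[|k].
  by apply/Ck_on0 => x _; exact: differentiable_coord.
apply/Ck_onS; split=> [x _|v]; first exact: differentiable_coord.
suff -> : 'D_v (fun x : 'rV_n => x ord0 i) = cst (v ord0 i) :> (_ -> R).
  exact: Ck_on_cst.
apply/funext => x; have := @derive_mx R _ 1 n id x v (@derivable_id _ _ x v).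
by rewrite derive_id => /matrixP/(_ ord0 i) /=; rewrite mxE => ->.
Qed.

Lemma Cinfty_onS V (U U' : set V) (f : V -> R) : U' `<=` U ->
  Cinfty_on U f -> Cinfty_on U' f.
Proof. by move=> UU h s x /UU; exact: h. Qed.

Lemma Cinfty_on_local V (U : set V) (f : V -> R) :
  (forall x, U x -> exists2 U', U' x & Cinfty_on U' f) -> Cinfty_on U f.
Proof. by move=> h s x /h[U' U'x]; exact. Qed.

End Calculus.

(** * Smooth maps *)

Section Smooth.
Variable R : realType.
Implicit Types L M N : dspace R.

Lemma smooth_at_near M (f g : M -> R) x :
  (\forall y \near x, f y = g y) -> smooth_at f x -> smooth_at g x.
Proof.
move=> fg [n [phi [w [h1 h2 h3]]]]; exists n, phi, w; split=> //.
by apply: filterS2 fg h3 => y ->.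
Qed.

Lemma smooth_gen M (g : M -> R) : dgen g -> smooth_fun g.
Proof.
move=> hg x; exists 1, (fun=> g), (fun z => z ord0 ord0); split=> //.
  exact: Cinfty_on_coord.
by near=> y; rewrite mxE.
Unshelve. all: by end_near. Qed.

(** Substituting the local expressions of the [f i] into [w] gives a C^oo function of finitely many
    generators. Consequently smoothness of a map can be tested on generators. *)
Lemma smooth_at_row M n (w : 'rV[R]_n -> R) (f : 'I_n -> M -> R) x :
  Cinfty_on setT w -> (forall i, smooth_at (f i) x) ->
  smooth_at (fun y => w (\row_i f i y)) x.
Proof.
move=> hw hf.
have /choice[D hD] i :
  exists D : {k & (('I_k -> M -> R) * ('rV[R]_k -> R))%type},
   [/\ forall j, dgen ((tagged D).1 j), Cinfty_on setT (tagged D).2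
      & \forall y \near x, f i y = (tagged D).2 (\row_j (tagged D).1 j y)].
  have [k [phi [v [h1 h2 h3]]]] := hf i.
  by exists (existT _ k (phi, v)).
(* All the generators involved form one family, indexed by a sigma type. *)
pose T : finType := {i : 'I_n & 'I_(tag (D i))}.
pose phi (k : 'I_#|T|) :=
  (tagged (D (tag (enum_val k)))).1 (tagged (enum_val k)).
pose v (z : 'rV[R]_#|T|) :=
  w (\row_i (tagged (D i)).2
       (\row_j z ord0 (enum_rank (Tagged (fun i => 'I_(tag (D i))) j)))).
exists #|T|, phi, v; split.
- by move=> k; have [h _ _] := hD (tag (enum_val k)); exact: h.
- apply: (@Cinfty_on_comp _ _ _ setT setT) => //; first exact: openT.
  move=> i; have [_ h _] := hD i.
  apply: (@Cinfty_on_comp _ _ _ setT setT) => //; first exact: openT.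
  by move=> j; exact: Cinfty_on_coord.
- have : \forall y \near x, forall i,
      f i y = (tagged (D i)).2 (\row_j (tagged (D i)).1 j y).
    by apply: filter_forall => i; have [_ _] := hD i.
  apply: filterS => y hy; rewrite /v; congr w; apply/rowP => i; rewrite !mxE hy.
  congr (tagged (D i)).2; apply/rowP => j.
  by rewrite !mxE /phi enum_rankK.
Qed.

Lemma smooth_map_gen M N (F : M -> N) : continuous F ->
  (forall g : N -> R, dgen g -> smooth_fun (g \o F)) -> smooth_map F.
Proof.
move=> cF hF; split=> // f hf x.
have [n [phi [w [h1 h2 h3]]]] := hf (F x).
apply: (@smooth_at_near _ (fun y => w (\row_i phi i (F y)))).
  have : \forall y \near x, f (F y) = w (\row_i phi i (F y)).
    exact: (cF x _ h3).
  by apply: filterS => y /= ->.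
by apply: (smooth_at_row (f := fun i => phi i \o F)) => // i; exact: hF.
Qed.

Lemma smooth_map_cst M N (a : N) : smooth_map (fun _ : M => a).
Proof.
split=> [x|f _ x]; first exact: cvg_cst.
exists 0, (fun _ _ => 0), (cst (f a)); split; [by case| exact: Cinfty_on_cst|].
by near=> y.
Unshelve. all: by end_near. Qed.

Lemma smooth_map_comp L M N (F : M -> N) (E : L -> M) :
  smooth_map F -> smooth_map E -> smooth_map (F \o E).
Proof.
move=> [cF sF] [cE sE]; split=> [x|f hf].
  by apply: continuous_comp; [exact: cE|exact: cF].
exact: (sE _ (sF _ hf)).
Qed.

Lemma smooth_map_val M (A : set M) : smooth_map (@set_val _ A : dsub A -> M).
Proof.
split; first exact: initial_continuous.
by move=> f hf; apply: smooth_gen; exists f.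
Qed.

Lemma continuous_at_sub (T : topologicalType) M (A : set M)
    (F : T -> dsub A) x :
  {for x, continuous (fun y => set_val (F y) : M)} -> {for x, continuous F}.
Proof.
by move=> cF U [? /= [[W oW <-]]] /= Wx /filterS; apply; apply: cF;
  exact: open_nbhs_nbhs.
Qed.

Lemma smooth_map_sub L M (A : set M) (F : L -> dsub A) :
  smooth_map (fun x => set_val (F x) : M) -> smooth_map F.
Proof.
move=> [cF sF]; apply: smooth_map_gen; last by move=> _ [f hf ->]; exact: sF.
by move=> x; apply: continuous_at_sub; exact: cF.
Qed.

Lemma smooth_map_fst M N : smooth_map (fst : dprod M N -> M).
Proof.
split; first by move=> x; exact: cvg_fst.
by move=> f hf; apply: smooth_gen; left; exists f.
Qed.

Lemma smooth_map_snd M N : smooth_map (snd : dprod M N -> N).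
Proof.
split; first by move=> x; exact: cvg_snd.
by move=> f hf; apply: smooth_gen; right; exists f.
Qed.

Lemma smooth_map_pair L M N (F : L -> M) (E : L -> N) :
  smooth_map F -> smooth_map E ->
  smooth_map (fun x => (F x, E x) : dprod M N).
Proof.
move=> [cF sF] [cE sE]; apply: smooth_map_gen.
  by move=> x; apply: cvg_pair; [exact: cF|exact: cE].
by move=> _ [[f hf ->]|[f hf ->]]; [exact: sF|exact: sE].
Qed.

(** Covers two cases at once: [smooth_curve], where [U] is an interval around 0, and the condition
    on the inverse [psi] in [is_chart]. *)
Definition smooth_from (V : normedModType R) M (U : set V) (c : V -> M) :=
  (forall t, U t -> {for t, continuous c}) /\
  (forall f : M -> R, smooth_fun f -> Cinfty_on U (f \o c)).

Lemma Cinfty_on_smooth_at (V : normedModType R) M (U : set V) (c : V -> M)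
    (f : M -> R) : open U ->
  (forall t, U t -> {for t, continuous c}) ->
  (forall g : M -> R, dgen g -> Cinfty_on U (g \o c)) ->
  (forall t, U t -> smooth_at f (c t)) -> Cinfty_on U (f \o c).
Proof.
move=> oU cc gc fc; apply: Cinfty_on_local => t Ut.
have [n [phi [w [h1 h2 h3]]]] := fc t Ut.
have : nbhs t (U `&` [set s | f (c s) = w (\row_i phi i (c s))]).
  by apply: filterI; [exact: open_nbhs_nbhs|exact: (cc t Ut _ h3)].
rewrite nbhsE => -[B [oB Bt] BU]; exists B => //.
apply: (eq_Cinfty_on (f := fun s => w (\row_i phi i (c s)))) => //.
  by move=> s /BU[_ /= <-].
apply: (@Cinfty_on_comp _ _ _ B setT) => // i.
by apply: Cinfty_onS (gc _ (h1 i)) => s /BU[].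
Qed.

Lemma smooth_from_gen (V : normedModType R) M (U : set V) (c : V -> M) :
  open U -> (forall t, U t -> {for t, continuous c}) ->
  (forall g : M -> R, dgen g -> Cinfty_on U (g \o c)) -> smooth_from U c.
Proof. by move=> oU cc gc; split=> // f hf; apply: Cinfty_on_smooth_at. Qed.

(** Meant for chart coordinates, which are smooth only at the points of the chart domain. *)
Lemma smooth_from_at (V : normedModType R) M (U : set V) (c : V -> M)
    (f : M -> R) : open U -> smooth_from U c ->
  (forall t, U t -> smooth_at f (c t)) -> Cinfty_on U (f \o c).
Proof.
move=> oU [cc sc]; apply: Cinfty_on_smooth_at => // g hg.
exact/sc/smooth_gen.
Qed.

Lemma smooth_from_comp (V : normedModType R) M N (U : set V) (c : V -> M)
    (F : M -> N) : smooth_map F -> smooth_from U c -> smooth_from U (F \o c).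
Proof.
move=> [cF sF] [cc sc]; split=> [t Ut|f hf].
  by apply: continuous_comp; [exact: cc|exact: cF].
exact: (sc _ (sF _ hf)).
Qed.

Lemma eq_continuous_at (S T : topologicalType) (U : set S) (c d : S -> T) t :
  open U -> {in U, c =1 d} -> U t ->
  {for t, continuous c} -> {for t, continuous d}.
Proof.
move=> oU cd Ut ct B; rewrite -cd ?inE // => /ct; rewrite !nbhs_simpl /=.
have : nbhs t U by exact: open_nbhs_nbhs.
by apply: filterS2 => s Us; rewrite /= cd // inE.
Qed.

Lemma eq_smooth_from (V : normedModType R) M (U : set V) (c d : V -> M) :
  open U -> {in U, c =1 d} -> smooth_from U c -> smooth_from U d.
Proof.
move=> oU cd [cc sc]; split=> [t Ut|f hf].
  exact: (eq_continuous_at oU cd Ut (cc t Ut)).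
apply: (eq_Cinfty_on (f := f \o c)) => //; last exact: sc.
by move=> t Ut /=; rewrite cd // inE.
Qed.

Lemma smooth_fromS (V : normedModType R) M (U U' : set V) (c : V -> M) :
  U' `<=` U -> smooth_from U c -> smooth_from U' c.
Proof.
by move=> UU [cc sc]; split=> [t /UU/cc //|f /sc]; exact: Cinfty_onS.
Qed.

Lemma smooth_from_pair (V : normedModType R) M N (U : set V)
    (c : V -> M) (d : V -> N) : open U -> smooth_from U c -> smooth_from U d ->
  smooth_from U (fun t => (c t, d t) : dprod M N).
Proof.
move=> oU [cc sc] [cd sd]; apply: smooth_from_gen => //.
  by move=> t Ut; apply: cvg_pair; [exact: cc|exact: cd].
by move=> _ [[f hf ->]|[f hf ->]]; [exact: sc|exact: sd].
Qed.

Lemma smooth_from_sub (V : normedModType R) M (A : set M) (U : set V)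
    (c : V -> dsub A) : open U ->
  smooth_from U (fun t => set_val (c t) : M) -> smooth_from U c.
Proof.
move=> oU [cc sc]; apply: smooth_from_gen => //.
  by move=> t Ut; apply: continuous_at_sub; exact: cc.
by move=> _ [f hf ->]; exact: sc.
Qed.

Lemma smooth_from_row (V : normedModType R) M n (U : set V) (W : set 'rV[R]_n)
    (psi : 'rV[R]_n -> M) (y : 'I_n -> V -> R) : open U ->
  (forall i, Cinfty_on U (y i)) -> (forall t, U t -> W (\row_i y i t)) ->
  smooth_from W psi -> smooth_from U (fun t => psi (\row_i y i t)).
Proof.
move=> oU hy UW [cpsi spsi]; split=> [t Ut|f hf].
  apply: (@continuous_comp _ _ _ (fun t => \row_i y i t) psi).
    apply: differentiable_continuous; apply: differentiable_row => i.
    exact: (hy i [::]).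
  by apply: cpsi; exact: UW.
by apply: (@Cinfty_on_comp _ _ _ U W (f \o psi)) => //; exact: spsi.
Qed.

End Smooth.

(** * Tangent vectors *)

Section Tangent.
Variable R : realType.
Implicit Types L M N : dspace R.

Lemma open_norm_lt (e : R) : open [set t : R | `|t| < e].
Proof.
rewrite (_ : [set t : R | _] = ball (0 : R) e); first exact: ball_open.
by apply/seteqP; split=> t; rewrite -ball_normE /= sub0r normrN.
Qed.

Lemma derive1_comp_row M e (c : R -> M) n (phi : 'I_n -> M -> R) w f :
  0 < e -> smooth_curve e c -> (forall i, dgen (phi i)) ->
  Cinfty_on setT w -> (\forall y \near c 0, f y = w (\row_i phi i y)) ->
  derive1 (f \o c) 0 =
  \sum_i 'D_(delta_mx 0 i) w (\row_i phi i (c 0)) * derive1 (phi i \o c) 0.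
Proof.
move=> e0 [cc sc] h1 h2 h3; have I0 : `|0 : R| < e by rewrite normr0.
rewrite derive1E.
have : \forall t \near (0:R), (f \o c) t = w (\row_i (phi i \o c) t).
  exact: (cc 0 I0 _ h3).
move/(near_eq_derive) => ->.
rewrite derive_comp_row.
- by apply: eq_bigr => i _; rewrite derive1E.
- by move=> i; apply: (sc _ (smooth_gen (h1 i)) [::]).
- exact: (h2 [::]).
Qed.

(** Near the common point [f] is a C^oo function of generators, so by the chain rule its derivative
    along a curve depends only on those of the generators. *)
Lemma derive1_ext M e e' (c d : R -> M) f :
  0 < e -> 0 < e' -> smooth_curve e c -> smooth_curve e' d -> c 0 = d 0 ->
  (forall g : M -> R, dgen g -> derive1 (g \o c) 0 = derive1 (g \o d) 0) ->
  smooth_at f (c 0) -> derive1 (f \o c) 0 = derive1 (f \o d) 0.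
Proof.
move=> e0 e0' sc sd cd gcd [n [phi [w [h1 h2 h3]]]].
rewrite (derive1_comp_row e0 sc h1 h2 h3); rewrite cd in h3 *.
rewrite (derive1_comp_row e0' sd h1 h2 h3).
by apply: eq_bigr => i _; rewrite gcd.
Qed.

Lemma velocityE M (c : R -> M) f :
  smooth_fun f -> velocity c f = derive1 (f \o c) 0.
Proof. by move=> hf; rewrite /velocity asboolT. Qed.

Lemma velocity_ext M e e' (c d : R -> M) :
  0 < e -> 0 < e' -> smooth_curve e c -> smooth_curve e' d -> c 0 = d 0 ->
  (forall g : M -> R, dgen g -> derive1 (g \o c) 0 = derive1 (g \o d) 0) ->
  velocity c = velocity d.
Proof.
move=> e0 e0' sc sd cd gcd; apply/funext => f; rewrite /velocity.
case: asboolP => // hf; exact: (derive1_ext e0 e0').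
Qed.

(** A velocity records only globally smooth functions, but these include the generators, which
    determine the derivatives of functions smooth at the single point [c 0], such as chart
    coordinates. *)
Lemma velocity_smooth_at M e e' (c d : R -> M) f :
  0 < e -> 0 < e' -> smooth_curve e c -> smooth_curve e' d -> c 0 = d 0 ->
  velocity c = velocity d ->
  smooth_at f (c 0) -> derive1 (f \o c) 0 = derive1 (f \o d) 0.
Proof.
move=> e0 e0' sc sd cd vcd; apply: (derive1_ext e0 e0') => // g hg.
by rewrite -!velocityE ?vcd //; exact: smooth_gen.
Qed.

Lemma near_eq_velocity M (c d : R -> M) :
  (\forall t \near 0, c t = d t) -> velocity c = velocity d.
Proof.
move=> cd; apply/funext => f; rewrite /velocity; case: asboolP => // hf.
rewrite !derive1E; apply: near_eq_derive.
by apply: filterS cd => t /= ->.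
Qed.

Lemma velocity_cst M (a : M) : velocity (fun _ : R => a) = @tzero R M.
Proof.
apply/funext => f; rewrite /velocity; case: asboolP => // hf.
exact: (derive1_cst (f a) 0).
Qed.

Lemma push_velocity M N (F : M -> N) (c : R -> M) :
  smooth_map F -> push F (velocity c) = velocity (F \o c).
Proof.
move=> [_ sF]; apply/funext => f; rewrite /push /velocity.
by case: asboolP => // hf; rewrite asboolT //; exact: sF.
Qed.

Lemma tangent_push M N (F : M -> N) (x : M) (v : tvec M) :
  smooth_map F -> tangent x v -> tangent (F x) (push F v).
Proof.
move=> sF [e [c [e0 sc c0 ->]]]; exists e, (F \o c); split=> //.
- exact: (smooth_from_comp sF sc).
- by rewrite /= c0.
- exact: push_velocity.
Qed.

Lemma push_comp L M N (F : M -> N) (E : L -> M) (v : tvec L) :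
  smooth_map F -> push F (push E v) = push (F \o E) v.
Proof.
move=> [_ sF]; apply/funext => f; rewrite /push.
by case: asboolP => // hf; rewrite asboolT //; exact: sF.
Qed.

(** The generators of [dsub A] are restrictions of smooth functions on [M], so their derivatives are
    still visible after inclusion. *)
Lemma push_val_inj M (A : set M) (p : dsub A) (v w : tvec (dsub A)) :
  tangent p v -> tangent p w ->
  push (@set_val _ A : dsub A -> M) v = push (@set_val _ A : dsub A -> M) w ->
  v = w.
Proof.
move=> [e [c [e0 sc c0 ->]]] [e' [d [e0' sd d0 ->]]].
rewrite !push_velocity; try exact: smooth_map_val.
move=> vcd; apply: (velocity_ext e0 e0') => //; first by rewrite c0 d0.
move=> _ [f hf ->]; have := congr1 (@^~ f) vcd.
by rewrite /= !velocityE.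
Qed.

(** Injectivity of the tangent inclusion leaves [v] as the only vector that [xget] can choose. *)
Lemma tangent_tsub M (A : set M) (p : dsub A) (v : tvec (dsub A)) :
  tangent p v ->
  tsub p (push (@set_val _ A : dsub A -> M) v) = v.
Proof.
move=> tv; rewrite /tsub; case: xgetP => [y -> [ty yv]|/(_ v)[]//].
exact: push_val_inj ty tv yv.
Qed.

(* clin only covers tangent vectors, and is used with - v = (- 2) v + v. *)
Lemma cval_topp M (mu : cotangent M) (v : tvec M) :
  tangent (cpt mu) v -> cval mu (topp v) = - cval mu v.
Proof.
move=> tv; have := clin (- 2) tv tv.
have -> : tadd (- 2) v v = topp v.
  by apply/funext => f; rewrite /tadd /topp mulNr mulrDl mul1r opprD addrNK.
by move=> ->; rewrite mulNr mulrDl mul1r opprD addrNK.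
Qed.

Lemma velocity_pair M N e e' (c c' : R -> M) (d d' : R -> N) :
  0 < e -> 0 < e' -> smooth_curve e c -> smooth_curve e d ->
  smooth_curve e' c' -> smooth_curve e' d' ->
  c 0 = c' 0 -> d 0 = d' 0 -> velocity c = velocity c' ->
  velocity d = velocity d' ->
  velocity (fun t => (c t, d t) : dprod M N) =
  velocity (fun t => (c' t, d' t) : dprod M N).
Proof.
move=> e0 e0' sc sd sc' sd' c0 d0 vc vd.
apply: (velocity_ext e0 e0').
- exact: (smooth_from_pair (@open_norm_lt e) sc sd).
- exact: (smooth_from_pair (@open_norm_lt e') sc' sd').
- by rewrite c0 d0.
- move=> _ [[f hf ->]|[f hf ->]].
    by have := congr1 (@^~ f) vc; rewrite /= !velocityE.
  by have := congr1 (@^~ f) vd; rewrite /= !velocityE.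
Qed.

Lemma curve_lift_sub M (A : set M) e (p : dsub A) (c : R -> M) : 0 < e ->
  smooth_curve e c -> (forall t, `|t| < e -> A (c t)) -> c 0 = set_val p ->
  exists c' : R -> dsub A, [/\ smooth_curve e c', c' 0 = p,
    forall t, `|t| < e -> set_val (c' t) = c t
  & push (@set_val _ A : dsub A -> M) (velocity c') = velocity c].
Proof.
move=> e0 sc Ac c0.
(* Outside the interval [c t] may leave [A]; the value [p] there is a default that does not affect
   the germ at 0. *)
pose c' t : dsub A :=
  if pselect (A (c t)) is left h then SigSub (mem_set h) else p.
have c'E t : `|t| < e -> set_val (c' t) = c t.
  by move=> te; rewrite /c'; case: pselect => // /(_ (Ac t te)).
have sc' : smooth_curve e c'.
  apply: (smooth_from_sub (@open_norm_lt e)).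
  apply: (eq_smooth_from (@open_norm_lt e) _ sc) => t; rewrite inE => te.
  by rewrite c'E.
exists c'; split=> //.
  by apply: val_inj; rewrite -!set_valE c'E ?normr0.
rewrite push_velocity; last exact: smooth_map_val.
apply: near_eq_velocity.
have : nbhs (0:R) [set t : R | `|t| < e].
  by apply: open_nbhs_nbhs; split; [exact: open_norm_lt|rewrite /= normr0].
by apply: filterS => t /= te; rewrite c'E.
Qed.

End Tangent.

(** * Lifting curves along submersions *)

Section Submersion.
Variable R : realType.
Implicit Types L M N : dspace R.

Lemma nbhs0_norm (S : set R) : nbhs (0:R) S ->
  exists2 d, 0 < d & forall t, `|t| < d -> S t.
Proof.
move=> /nbhs_ballP[d /= d0 dS]; exists d => // t td; apply: dS.
by rewrite -ball_normE /= sub0r normrN.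
Qed.

(** The coordinates that get replaced have the same derivative at 0 before and after, because [b]
    and [F \o c] have the same velocity; so the velocity of [c] survives. *)
Lemma submersion_lift M N (F : M -> N) e (c : R -> M) (b : R -> N) :
  is_submersion F -> 0 < e -> smooth_curve e c -> smooth_curve e b ->
  b 0 = F (c 0) -> velocity b = velocity (F \o c) ->
  exists e' (c' : R -> M), [/\ 0 < e' <= e, smooth_curve e' c', c' 0 = c 0,
    (forall t, `|t| < e' -> F (c' t) = b t) & velocity c' = velocity c].
Proof.
move=> [sF subF] e0 sc sb b0 vb.
have [m [k [U [W [phi [psi [U' [W' [phi' [psi' []]]]]]]]]]] := subF (c 0).
move=> [[oU oW] phiK psiK [_ phis] [cpsi spsi]].
move=> [[oU' _] phiK' _ [_ phis'] _] Uc0 FU Fphi.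
have Ub0 : U' (b 0) by rewrite b0; apply: FU; exists (c 0).
have z0 : `|0 : R| < e by rewrite normr0.
(* In the charts, F is the projection on the first m coordinates: replace those
   of c by the coordinates of b and keep the others. *)
pose y (i : 'I_(m + k)) (t : R) : R := match fintype.split i with
  | inl j => phi' (b t) ord0 j
  | inr j => phi (c t) ord0 (rshift m j) end.
have yE t : \row_i y i t = row_mx (phi' (b t)) (rsubmx (phi (c t))).
  by apply/rowP => i; rewrite !mxE /y; case: fintype.split => j; rewrite ?mxE.
have y0 : \row_i y i 0 = phi (c 0) by rewrite yE b0 Fphi // hsubmxK.
(* [e1] keeps both given curves inside the chart domains; [e2] below keeps the new coordinates
   inside [W], where [psi] inverts [phi]. *)
have [e1 e10 e1P] : exists2 d, 0 < d & forall t, `|t| < d ->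
    [/\ `|t| < e, U (c t) & U' (b t)].
  apply: nbhs0_norm.
  have n1 : nbhs (0:R) [set t : R | `|t| < e].
    by apply: open_nbhs_nbhs; split; first exact: open_norm_lt.
  have n2 : \forall t \near (0:R), U (c t).
    by apply: (sc.1 0 z0); exact: open_nbhs_nbhs.
  have n3 : \forall t \near (0:R), U' (b t).
    by apply: (sb.1 0 z0); exact: open_nbhs_nbhs.
  by apply: filterS3 n1 n2 n3 => t.
pose I1 := [set t : R | `|t| < e1].
have oI1 : open I1 by exact: open_norm_lt.
have I10 : I1 0 by rewrite /I1 /= normr0.
have sc1 : smooth_from I1 c by apply: smooth_fromS sc => t /e1P[].
have sb1 : smooth_from I1 b by apply: smooth_fromS sb => t /e1P[].
have phic i : Cinfty_on I1 (fun t => phi (c t) ord0 i).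
  apply: (smooth_from_at (f := fun z => phi z ord0 i) oI1 sc1).
  move=> t /e1P[_ Uc _].
  exact: phis.
have phib i : Cinfty_on I1 (fun t => phi' (b t) ord0 i).
  apply: (smooth_from_at (f := fun z => phi' z ord0 i) oI1 sb1).
  move=> t /e1P[_ _ Ub].
  exact: phis'.
have sy i : Cinfty_on I1 (y i) by rewrite /y; case: fintype.split.
have dy i : differentiable (y i) 0 by exact: (sy i [::]).
have [e2 e20 e2P] : exists2 d, 0 < d & forall t, `|t| < d ->
    W (\row_i y i t).
  apply: nbhs0_norm.
  have cy : {for 0, continuous (fun t => \row_i y i t)}.
    by apply: differentiable_continuous; exact: differentiable_row.
  apply: cy; apply: open_nbhs_nbhs; split=> //.
  by rewrite y0; have [] := phiK _ Uc0.
pose e' := Num.min e1 e2.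
have e'0 : 0 < e' by rewrite lt_min e10.
have lt1 (t : R) : `|t| < e' -> `|t| < e1 by rewrite lt_min => /andP[].
have lt2 (t : R) : `|t| < e' -> `|t| < e2 by rewrite lt_min => /andP[].
(* Otherwise [e1P] would apply to [e] itself and give [e < e]. *)
have e'e : e' <= e.
  rewrite leNgt; apply/negP => ee'.
  have : `|e| < e1 by apply: lt1; rewrite gtr0_norm.
  by move=> /e1P[]; rewrite gtr0_norm // ltxx.
pose c' t := psi (\row_i y i t).
have sc' : smooth_curve e' c'.
  apply: (smooth_from_row (W := W)).
  - exact: open_norm_lt.
  - by move=> i; apply: Cinfty_onS (sy i) => t /lt1.
  - by move=> t /lt2/e2P.
  - by split.
have c'0 : c' 0 = c 0 by rewrite /c' y0; have [] := phiK _ Uc0.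
exists e', c'; split=> //; first by rewrite e'0.
  move=> t te'; have [_ Uc Ub] := e1P t (lt1 t te').
  have [Uc' pc'] := psiK _ (e2P t (lt2 t te')).
  have UFc' : U' (F (c' t)) by apply: FU; exists (c' t).
  rewrite -(phiK' _ UFc').2 -[RHS](phiK' _ Ub).2 Fphi // pc' yE.
  by rewrite row_mxKl.
apply: (velocity_ext e'0 e0) => // g /smooth_gen hg.
have dg : differentiable (g \o psi) (phi (c 0)).
  by apply: (spsi g hg [::]); have [] := phiK _ Uc0.
(* Both curves are near 0 [psi] of coordinate functions agreeing at 0; the chain rule for [g \o psi]
   leaves only the derivatives of these to compare. *)
have gc : \forall t \near (0:R), (g \o c) t =
    (g \o psi) (\row_i (fun i t => phi (c t) ord0 i) i t).
  have : nbhs (0:R) I1 by exact: open_nbhs_nbhs.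
  apply: filterS => t /e1P[_ Uc _] /=.
  rewrite (_ : \row_i _ = phi (c t)) ?(phiK _ Uc).2 //.
  by apply/rowP => i; rewrite mxE.
rewrite !derive1E (near_eq_derive _ gc).
have r0 : \row_i phi (c 0) ord0 i = phi (c 0).
  by apply/rowP => i; rewrite mxE.
rewrite (derive_comp_row (f := g \o psi)) ?y0 //.
rewrite derive_comp_row ?r0 //; last by move=> i; exact: (phic i [::]).
apply: eq_bigr => i _; congr (_ * _); rewrite /y.
case: splitP => j ij; last first.
  have -> // : i = rshift m j by exact: val_inj.
have {ij}-> : i = lshift k j by exact: val_inj.
(* A replaced coordinate: equality of velocities is applied to a coordinate of [phi'], smooth only
   on [U']. *)
have F0 := velocity_smooth_at (f := fun z => phi' z ord0 j) e0 e0 sb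
  (smooth_from_comp sF sc) b0 vb (phis' j _ Ub0).
move: F0; rewrite !derive1E => ->; apply: near_eq_derive.
have : nbhs (0:R) I1 by exact: open_nbhs_nbhs.
by apply: filterS => t /e1P[_ Uc _] /=; rewrite Fphi // mxE.
Qed.

End Submersion.

(** * Groupoids *)

Section GroupoidFacts.
Variables (R : realType) (H : groupoid R).

(** [b = b (a a^-1) = (b a) a^-1 = a^-1]; each product needs its own composability proof, and
    [mul_congr] passes from one to another. *)
Lemma inv_uniq (a b : arr H) (e : tgt b = src a) :
  mul e = one (tgt a) -> b = inv a.
Proof.
move=> ba.
have e2 : tgt a = src (inv a) by rewrite src_inv.
have e3 : tgt (mul e) = src (inv a) by rewrite tgt_mul.
have e4 : tgt b = src (mul e2) by rewrite src_mul.
have eb : tgt b = src (one (tgt b)) by rewrite src_one.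
have ei : tgt (one (src (inv a))) = src (inv a) by rewrite tgt_one.
rewrite -[LHS](mul_one eb) -[RHS](one_mul ei).
transitivity (mul e4); last first.
  by rewrite -(mul_assoc e3 e4); apply: mul_congr; rewrite ?ba ?src_inv.
by apply: mul_congr; rewrite ?mul_inv ?e.
Qed.

(** [a = (a^-1 a) a = a^-1 (a a) = a^-1 a]. Applied to images of identities under a morphism. *)
Lemma idem_one (a : arr H) (e : tgt a = src a) : mul e = a -> a = one (src a).
Proof.
move=> aa.
have e1 : tgt (inv a) = src a by rewrite tgt_inv.
have e3 : tgt (mul e1) = src a by rewrite tgt_mul.
have e4 : tgt (inv a) = src (mul e) by rewrite src_mul.
have ea : tgt (one (src a)) = src a by rewrite tgt_one.
transitivity (mul e3).
  by rewrite -[LHS](one_mul ea); apply: mul_congr; rewrite ?inv_mul ?e.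
rewrite (mul_assoc e3 e4); transitivity (mul e1); first exact: mul_congr.
by rewrite inv_mul e.
Qed.

Lemma inv_one (q : obj H) : inv (one q) = one q.
Proof.
have e : tgt (one q) = src (one q) by rewrite tgt_one src_one.
apply/esym/(inv_uniq (e := e)).
have e' : tgt (one (src (one q))) = src (one q) by rewrite tgt_one.
by rewrite tgt_one -[RHS](one_mul e'); apply: mul_congr; rewrite ?src_one.
Qed.

(** An identity is its own inverse. This places the translated vectors at the base point [x]. *)
Lemma rtrans_inv_one (x : arr H) : rtrans_inv (srcfib_one (src x)) = x.
Proof.
have e : tgt (one (src x)) = src x by rewrite tgt_one.
rewrite -[RHS](one_mul e); apply: mul_congr => //.
by rewrite -[RHS]inv_one.
Qed.

Lemma ltrans_one (x : arr H) : ltrans (srcfib_one (tgt x)) = x.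
Proof.
have e : tgt x = src (one (tgt x)) by rewrite src_one.
by rewrite -[RHS](mul_one e); apply: mul_congr.
Qed.

(** Ensures that on the algebroid [tsub] returns a genuine preimage and not its default [tzero].
    Together with [smooth_translations] it is what the morphism argument asks of a groupoid; both
    are proved for the prolongation from the Lie structure of [G]. *)
Definition srcfib_liftable := forall (q : obj H) X, algebroid q X ->
  exists Y : tvec (srcfib q), tangent (srcfib_one q) Y /\
    push (@set_val _ (srcfib_set q) : srcfib q -> arr H) Y = X.

Definition smooth_translations := forall x : arr H,
  smooth_map (@rtrans_inv R H x) /\ smooth_map (@ltrans R H x).

End GroupoidFacts.

(** * Morphisms of groupoids and related covectors *)

Section MorphismFacts.
Variables (R : realType) (H H' : groupoid R) (chi : arr H -> arr H').
Hypothesis hchi : is_morphism chi.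

Lemma src_morphism x : src (chi x) = base_map chi (src x).
Proof.
have e : tgt (one (src x)) = src x by rewrite tgt_one.
by have [e' he] := hchi.2 _ _ e; rewrite -[in LHS](one_mul e) he src_mul.
Qed.

Lemma tgt_morphism x : tgt (chi x) = base_map chi (tgt x).
Proof.
have e : tgt x = src (one (tgt x)) by rewrite src_one.
by have [e' _] := hchi.2 _ _ e.
Qed.

Lemma one_morphism q : chi (one q) = one (base_map chi q).
Proof.
have e : tgt (one q) = src (one q) by rewrite tgt_one src_one.
have [e' he] := hchi.2 _ _ e; apply: (idem_one (e := e')).
rewrite -he; congr chi.
have e1 : tgt (one (src (one q))) = src (one q) by rewrite tgt_one.
by rewrite -[RHS](one_mul e1); apply: mul_congr; rewrite ?src_one.
Qed.

Lemma inv_morphism x : chi (inv x) = inv (chi x).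
Proof.
have e : tgt (inv x) = src x by rewrite tgt_inv.
have [e' he] := hchi.2 _ _ e; apply: (inv_uniq (e := e')).
by rewrite -he inv_mul one_morphism tgt_morphism.
Qed.

Lemma srcfib_map_subproof q q' (hq : base_map chi q = q') (h : srcfib q) :
  srcfib_set q' (chi (set_val h)).
Proof. by rewrite /srcfib_set /= src_morphism (set_valP h). Qed.

(** The fibre [q'] comes with an equation because translations by [chi x] start from fibres over
    [src (chi x)] and [tgt (chi x)], which equal values of [base_map] only propositionally. *)
Definition srcfib_map q q' (hq : base_map chi q = q') (h : srcfib q) :
  srcfib q' := SigSub (mem_set (srcfib_map_subproof hq h)).

Lemma smooth_srcfib_map q q' (hq : base_map chi q = q') :
  smooth_map (srcfib_map hq).
Proof.
apply: smooth_map_sub.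
exact: (smooth_map_comp hchi.1 (@smooth_map_val _ _ _)).
Qed.

Lemma srcfib_map_one q q' (hq : base_map chi q = q') :
  srcfib_map hq (srcfib_one q) = srcfib_one q'.
Proof. by apply: val_inj; rewrite /= -hq; exact: one_morphism. Qed.

(** The right-hand side is tangent to the target fibre at its identity and includes to the given
    vector, so [tangent_tsub] recognizes it. *)
Lemma tsub_morphism q q' (hq : base_map chi q = q') (Y : tvec (srcfib q)) :
  tangent (srcfib_one q) Y ->
  tsub (srcfib_one q')
    (push chi (push (@set_val _ (srcfib_set q) : srcfib q -> arr H) Y)) =
  push (srcfib_map hq) Y.
Proof.
move=> tY; rewrite (push_comp _ _ hchi.1).
rewrite -[RHS](tangent_tsub (p := srcfib_one q')); last first.
  rewrite -(srcfib_map_one hq).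
  by apply: tangent_push => //; exact: smooth_srcfib_map.
by rewrite (push_comp _ _ (@smooth_map_val _ _ _)).
Qed.

Hypotheses (lH : srcfib_liftable H) (tH : smooth_translations H)
  (tH' : smooth_translations H').
Variables (mu : cotangent (arr H)) (mu' : cotangent (arr H')).
Hypothesis hmu : cot_related chi mu mu'.

Lemma tsub_algebroid q X : algebroid q X ->
  tangent (srcfib_one q) (tsub (srcfib_one q) X) /\
  push (@set_val _ (srcfib_set q) : srcfib q -> arr H)
    (tsub (srcfib_one q) X) = X.
Proof. by move=> /lH[Y [tY <-]]; rewrite tangent_tsub. Qed.

(** On source fibres [chi] intertwines [r_x o i] with [r_(chi x) o i], because it preserves inverses
    and products; the sign in [right_inv] leaves both covectors by linearity. *)
Lemma cot_src_related : dual_related chi (cot_src mu) (cot_src mu').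
Proof.
case: hmu => ptE hval; split; first by rewrite /= ptE src_morphism.
move=> X /= aX; have [tY pY] := tsub_algebroid aX.
set x := cpt mu in ptE hval aX tY pY *; set Y := tsub _ _ in tY pY.
have sr := (tH x).1; have sr' := (tH' (chi x)).1.
have trY : tangent x (push (@rtrans_inv _ _ x) Y).
  by rewrite -[x in tangent x _]rtrans_inv_one; exact: tangent_push.
rewrite /right_inv -/Y ptE cval_topp // hval // -[in RHS]pY.
have hq : base_map chi (src x) = src (chi x) by rewrite src_morphism.
rewrite (tsub_morphism hq tY) (push_comp _ _ sr').
have <- : chi \o @rtrans_inv _ _ x = @rtrans_inv _ _ (chi x) \o srcfib_map hq.
  apply/funext => h; rewrite /= /rtrans_inv.
  have [e' ->] := hchi.2 _ _ (rtrans_inv_subproof h).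
  by apply: mul_congr => //; rewrite inv_morphism.
rewrite -(push_comp _ _ hchi.1) cval_topp // ptE.
exact: tangent_push hchi.1 trY.
Qed.

Lemma cot_tgt_related : dual_related chi (cot_tgt mu) (cot_tgt mu').
Proof.
case: hmu => ptE hval; split; first by rewrite /= ptE tgt_morphism.
move=> X /= aX; have [tY pY] := tsub_algebroid aX.
set x := cpt mu in ptE hval aX tY pY *; set Y := tsub _ _ in tY pY.
have sl := (tH x).2; have sl' := (tH' (chi x)).2.
have tlY : tangent x (push (@ltrans _ _ x) Y).
  by rewrite -[x in tangent x _]ltrans_one; exact: tangent_push.
rewrite /left_inv -/Y ptE hval // -[in RHS]pY.
have hq : base_map chi (tgt x) = tgt (chi x) by rewrite tgt_morphism.
rewrite (tsub_morphism hq tY) !push_comp //; last exact: hchi.1.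
congr (cval mu' (push _ Y)); apply/funext => h; rewrite /= /ltrans.
have [e' ->] := hchi.2 _ _ (ltrans_subproof h).
exact: mul_congr.
Qed.

End MorphismFacts.

(** * The prolongation *)

Section ProlongationFacts.
Variables (R : realType) (G : groupoid R).

Lemma smooth_psrc : smooth_map (@psrc R G).
Proof.
exact: (smooth_map_comp (smooth_map_comp
  (@smooth_map_fst _ _ _) (@smooth_map_fst _ _ _)) (@smooth_map_val _ _ _)).
Qed.

Lemma smooth_pmid : smooth_map (@pmid R G).
Proof.
exact: (smooth_map_comp (smooth_map_comp
  (@smooth_map_snd _ _ _) (@smooth_map_fst _ _ _)) (@smooth_map_val _ _ _)).
Qed.

Lemma smooth_ptgt : smooth_map (@ptgt R G).
Proof.
exact: (smooth_map_comp (@smooth_map_snd _ _ _) (@smooth_map_val _ _ _)).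
Qed.

Lemma smooth_map_prolong (L : dspace R) (F : L -> prolong_arr G) :
  smooth_map (fun y => psrc (F y)) -> smooth_map (fun y => pmid (F y)) ->
  smooth_map (fun y => ptgt (F y)) -> smooth_map F.
Proof.
move=> h1 h2 h3; apply: smooth_map_sub.
have := smooth_map_pair (smooth_map_pair h1 h2) h3; congr smooth_map.
by apply/funext => y; rewrite /psrc /pmid /ptgt -!surjective_pairing.
Qed.

Lemma smooth_map_composable (L : dspace R) (F : L -> composable G) :
  smooth_map (fun y => fst2 (F y)) -> smooth_map (fun y => snd2 (F y)) ->
  smooth_map F.
Proof.
move=> h1 h2; apply: smooth_map_sub.
have := smooth_map_pair h1 h2; congr smooth_map.
by apply/funext => y; rewrite /fst2 /snd2 -surjective_pairing.
Qed.

Lemma smooth_iG2 : smooth_map (@iG2 R G).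
Proof.
have h1 : smooth_map (@fst2 R G).
  exact: smooth_map_comp (@smooth_map_fst _ _ _) (@smooth_map_val _ _ _).
have h2 : smooth_map (@snd2 R G).
  exact: smooth_map_comp (@smooth_map_snd _ _ _) (@smooth_map_val _ _ _).
by apply: smooth_map_prolong.
Qed.

Lemma iG2_inj : injective (@iG2 R G).
Proof.
move=> p q pq; apply: val_inj; rewrite -!set_valE.
rewrite [LHS]surjective_pairing [RHS]surjective_pairing.
congr (_, _); first exact: (congr1 (@pmid _ _) pq).
exact: (congr1 (@ptgt _ _) pq).
Qed.

Hypothesis hG : is_lie_groupoid G.

Lemma smooth_mul (L : dspace R) (a b : L -> arr G)
    (e : forall y, tgt (a y) = src (b y)) :
  smooth_map a -> smooth_map b -> smooth_map (fun y => mul (e y)).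
Proof.
move=> ha hb; have [_ _ _ _ sm] := hG.
pose k y : composable G :=
  SigSub (mem_set (e y : @composable_set R G (a y, b y))).
have sk : smooth_map k by exact: smooth_map_composable.
have := smooth_map_comp sm sk; congr smooth_map.
by apply/funext => y; apply: mul_congr.
Qed.

Lemma smooth_inv : smooth_map (@inv R G).
Proof. by have [] := hG. Qed.

(** With [x = (a, b, c)], the maps are [(g, h, r) |-> (r, h^-1 b, c)] and
    [(g, h, r) |-> (a, b h, r)], smooth in each component. *)
Lemma smooth_translations_prolongation : smooth_translations (prolongation G).
Proof.
move=> x; split.
  have sv : smooth_map (@set_val _ (srcfib_set (src x)) :
      srcfib (src x) -> arr (prolongation G)) by exact: smooth_map_val.
  apply: smooth_map_prolong.
  - exact: smooth_map_comp smooth_ptgt sv.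
  - apply: smooth_mul; last exact: smooth_map_cst.
    exact: smooth_map_comp smooth_inv (smooth_map_comp smooth_pmid sv).
  - exact: smooth_map_cst.
have sv : smooth_map (@set_val _ (srcfib_set (tgt x)) :
    srcfib (tgt x) -> arr (prolongation G)) by exact: smooth_map_val.
apply: smooth_map_prolong.
- exact: smooth_map_cst.
- apply: smooth_mul; first exact: smooth_map_cst.
  exact: smooth_map_comp smooth_pmid sv.
- exact: smooth_map_comp smooth_ptgt sv.
Qed.

Lemma push_tzero (M N : dspace R) (F : M -> N) :
  push F (@tzero R M) = @tzero R N.
Proof. by apply/funext => f; rewrite /push; case: asboolP. Qed.

Lemma smooth_curve_cst (M : dspace R) e (a : M) : smooth_curve e (fun=> a).
Proof.
split=> [t _|f _]; first exact: cst_continuous.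
exact: (@Cinfty_on_cst _ _ _ (f a)).
Qed.

Lemma srcfib_liftable_prolongation : srcfib_liftable (prolongation G).
Proof.
move=> /= q X [[e [c [e0 sc c0 XE]]] X0].
have [_ [sub_src [sm_tgt _]] _ _ _] := hG.
have [sm_src _] := sub_src.
pose g := @psrc _ _ \o c; pose h := @pmid _ _ \o c; pose r := @ptgt _ _ \o c.
have sg : smooth_curve e g by exact: smooth_from_comp smooth_psrc sc.
have sh : smooth_curve e h by exact: smooth_from_comp smooth_pmid sc.
have sr : smooth_curve e r by exact: smooth_from_comp smooth_ptgt sc.
have g0 : g 0 = q by rewrite /g /= c0.
have h0 : h 0 = one (src q) by rewrite /h /= c0.
have r0 : r 0 = q by rewrite /r /= c0.
have vg : velocity g = @tzero R (arr G).
  by rewrite -(push_velocity _ smooth_psrc) -XE.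
(* The sources of [h] and [g] coincide and [g] has zero velocity, so the constant curve has the
   velocity required for the first lift. *)
have vh : velocity (fun _ : R => src q) = velocity (@src _ G \o h).
  rewrite velocity_cst (_ : _ \o h = @src _ G \o g).
    by rewrite -(push_velocity _ sm_src) vg push_tzero.
  by apply/funext => t; rewrite /= (prolongP (c t)).1.
have sqh : src q = src (h 0) by rewrite h0 src_one.
have [e1 [h1 [/andP[e10 e1e] sh1 h10 srch1 vh1]]] :=
  submersion_lift sub_src e0 sh (smooth_curve_cst e (src q)) sqh vh.
have sr1 : smooth_curve e1 r.
  by apply: smooth_fromS sr => t /= /lt_le_trans; apply.
have vr : velocity (@tgt _ G \o h1) = velocity (@src _ G \o r).
  (* Moving [h] kept its velocity, hence that of its target curve, which along [c] is the source of
     [r]; so [r] can be lifted in turn. *)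
  rewrite -(push_velocity _ sm_tgt) vh1 (push_velocity _ sm_tgt).
  by congr velocity; apply/funext => t; rewrite /= (prolongP (c t)).2.
have tr0 : (@tgt _ G \o h1) 0 = src (r 0) by rewrite /= h10 h0 r0 tgt_one.
have [e2 [r2 [/andP[e20 e21] sr2 r20 srcr2 vr2]]] :=
  submersion_lift sub_src e10 sr1 (smooth_from_comp sm_tgt sh1) tr0 vr.
have lt21 (t : R) : `|t| < e2 -> `|t| < e1.
  by move=> /lt_le_trans; apply.
have sh2 : smooth_curve e2 h1 by apply: smooth_fromS sh1 => t /lt21.
pose k t : dprod (dprod (arr G) (arr G)) (arr G) := ((q, h1 t), r2 t).
have sqh2 : smooth_curve e2 (fun t => (q, h1 t) : dprod (arr G) (arr G)).
  apply: (smooth_from_pair (@open_norm_lt _ e2) _ sh2).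
  exact: smooth_curve_cst.
have sk : smooth_curve e2 k.
  exact: (smooth_from_pair (@open_norm_lt _ e2) sqh2 sr2).
have kP t : `|t| < e2 -> prolong_set (k t).
  by move=> te; split=> /=; rewrite ?srch1 ?srcr2 //; exact: lt21.
have k0 : k 0 = set_val (@one R (prolongation G) q).
  by rewrite /k h10 h0 r20 r0.
have [c1 [sc1 c10 c1E vc1]] := curve_lift_sub e20 sk kP k0.
have sgh : smooth_curve e (fun t => (g t, h t) : dprod (arr G) (arr G)).
  exact: (smooth_from_pair (@open_norm_lt _ e) sg sh).
have vc1c : velocity c1 = X.
  have t1 : tangent (@one R (prolongation G) q) (velocity c1).
    by exists e2, c1.
  have t2 : tangent (@one R (prolongation G) q) X by exists e, c.
  (* The velocities are compared in the triple product of [G], component by component. *)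
  apply: (push_val_inj t1 t2); rewrite vc1 XE push_velocity; last first.
    exact: smooth_map_val.
  have -> : @set_val _ (prolong_set (G := G)) \o c =
      (fun t => ((g t, h t), r t)).
    apply/funext => t; rewrite /g /h /r /=.
    by rewrite /psrc /pmid /ptgt -!surjective_pairing.
  apply: (velocity_pair e20 e0 sqh2 sr2 sgh sr) => //=.
  - by rewrite g0 h10.
  - apply: (velocity_pair e20 e0 _ sh2 sg sh) => //.
    + exact: smooth_curve_cst.
    + by rewrite velocity_cst vg.
(* Second corestriction, to the source fibre: the first component of [k] is constantly [q]. *)
have c1P t : `|t| < e2 -> @srcfib_set _ (prolongation G) q (c1 t).
  by move=> te; rewrite /srcfib_set /= /psrc (c1E t te).
have c1one : c1 0 = set_val (@srcfib_one R (prolongation G) q) by [].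
have [c2 [sc2 c20 _ vc2]] := curve_lift_sub e20 sc1 c1P c1one.
exists (velocity c2); split; last by rewrite vc2.
by exists e2, c2.
Qed.

End ProlongationFacts.

(** * The submanifold generated by a Lagrangian *)

Section SigmaFacts.
Variables (R : realType) (G G' : groupoid R).
Variable chi : arr (prolongation G) -> arr (prolongation G').
Hypothesis smooth_chi : smooth_map chi.
Hypothesis hG2 : range (@iG2 R G) = chi @^-1` range (@iG2 R G').

(** The restriction of [chi] to [G_2], read off the last two components of the image, which are
    composable in any arrow of the prolongation. *)
Definition composable_map (p : composable G) : composable G' :=
  SigSub (mem_set ((prolongP (chi (iG2 p))).2 :
    @composable_set R G' (pmid (chi (iG2 p)), ptgt (chi (iG2 p))))).

Lemma smooth_composable_map : smooth_map composable_map.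
Proof.
have s := smooth_map_comp smooth_chi (@smooth_iG2 R G).
apply: smooth_map_composable.
  exact: smooth_map_comp (@smooth_pmid _ _) s.
exact: smooth_map_comp (@smooth_ptgt _ _) s.
Qed.

Lemma iG2_composable_map p : iG2 (composable_map p) = chi (iG2 p).
Proof.
have [p' _ p'E] : (chi @^-1` range (@iG2 R G')) (iG2 p).
  by rewrite -hG2; exists p.
have pm : psrc (chi (iG2 p)) = pmid (chi (iG2 p)) by rewrite -p'E.
by apply: prolong_eq.
Qed.

Lemma Sigma_related (L : composable G -> R) (L' : composable G' -> R) mu mu' :
  smooth_fun L' ->
  (forall p p', chi (iG2 p) = iG2 p' -> L p = L' p') ->
  cot_related chi mu mu' -> Sigma L' mu' -> Sigma L mu.
Proof.
move=> hL' hLL' [ptE hval] [p' [ptE' hv']].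
(* Here the preimage of [G'_2] is included in [G_2]; the converse inclusion underlies
   [iG2_composable_map]. *)
have [p _ pE] : range (@iG2 R G) (cpt mu).
  by rewrite hG2 /= -ptE; exists p'.
exists p; split=> // v tv.
have pp' : composable_map p = p'.
  by apply: iG2_inj; rewrite iG2_composable_map pE -ptE.
have tv' := tangent_push (@smooth_iG2 R G) tv.
rewrite hval -?pE // push_comp //.
have -> : chi \o @iG2 R G = @iG2 R G' \o composable_map.
  by apply/funext => q /=; rewrite iG2_composable_map.
rewrite -push_comp; last exact: smooth_iG2.
rewrite hv'; last first.
  by rewrite -pp'; apply: tangent_push => //; exact: smooth_composable_map.
(* [push] vanishes on non-smooth functions, so its value at [L'] depends on [hL']. *)
rewrite /push asboolT //; congr v.
by apply/funext => q /=; apply/esym/hLL'; rewrite iG2_composable_map.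
Qed.

End SigmaFacts.

Theorem theorem4p13 (R : realType) (G G' : groupoid R)
  (hG : is_lie_groupoid G) (hG' : is_lie_groupoid G')
  (L : composable G -> R) (L' : composable G' -> R)
  (hL : smooth_fun L) (hL' : smooth_fun L')
  (chi : arr (prolongation G) -> arr (prolongation G'))
  (hchi : is_morphism chi)
  (hG2 : range (@iG2 R G) = chi @^-1` range (@iG2 R G'))
  (hLL' : forall (p : composable G) (p' : composable G'),
     chi (iG2 p) = iG2 p' -> L p = L' p')
  (mu : cotangent (arr (prolongation G)))
  (mu' : cotangent (arr (prolongation G')))
  (hmu : cot_related chi mu mu') :
  [/\ Sigma L' mu' -> Sigma L mu,
      dual_related chi (cot_src mu) (cot_src mu')
    & dual_related chi (cot_tgt mu) (cot_tgt mu')].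
Proof.
(* Vectors are lifted to source fibres on the side of [G]; on the side of [G'] the lifts are their
   images under [chi]. *)
have lG := srcfib_liftable_prolongation hG.
have tG := smooth_translations_prolongation hG.
have tG' := smooth_translations_prolongation hG'.
split.
- exact: (Sigma_related hchi.1 hG2 hL' hLL' hmu).
- exact: cot_src_related.
- exact: cot_tgt_related.
Qed.
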